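(* Let $0\le k\le d$, let $K$ be a compact subset of the metric space of manifold functions $(X_k,d_{X_k})$, and let $Y$ be a Banach space. Let $0\le s\le r$ and $t>0$, and let $\{\phi_{n,m}\}_{1\le n,\,1\le m\le\kappa(n)}$ be an $(r,s,t)$-convergence sequence, with induced encoders $\{\Phi_n\}$. Suppose that $\mathcal{G}:K\to Y$ is a continuous mapping. Then for any $\epsilon>0$ there exist positive integers $p,q$, a continuous mapping $\tilde{\mathcal{G}}:\mathbb{R}^{2\kappa(q)}\to\mathbb{R}^p$ and $u\in C(\mathbb{R}^p,Y)$ such that $$\sup_{(M,f_M)\in K}\left\lVert\mathcal{G}(M,f_M)-u\circ\tilde{\mathcal{G}}(\Phi_q(M,f_M))\right\rVert_Y<\epsilon.$$
   Context: **Domain and function spaces.** $V:=[0,1]^d$. $C(V)$ is the space of continuous real functions with the sup norm, $C^r(V)$ ($r$ a nonnegative integer) the usual space of $r$ times continuously differentiable functions with its usual norm, $H^s(V)$ ($s\ge 0$) the usual Hilbert Sobolev space. A prime denotes the dual Banach space with operator norm. $C(\mathbb{R}^p,Y)$ is the set of continuous maps from $\mathbb{R}^p$ to $Y$. **Manifold functions.** $\mathcal{H}^k$ is the $k$-dimensional Hausdorff measure. Let $\mathcal{M}_k$ be the set of all finite unions $\cup_{i=1}^m M_i$, $m\ge1$, where each $M_i\subset V$ is a compact $k$-dimensional Lipschitz manifold (possibly with boundary) with $\mathcal{H}^k(M_i)<\infty$, and for $i\ne j$ the intersection $M_i\cap M_j$ is a manifold of dimension less than $k$ or empty. For $k=0$,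 elements of $\mathcal{M}_0$ are finite sets of points of $V$. Set $X_k:=\{(M,f_M):M\in\mathcal{M}_k,\ f_M\in L^2(M)\}$, with $L^2(M)$ taken with respect to $\mathcal{H}^k$ (for $k=0$, $f_M$ is a real function on the points). For $(M,f_M)\in X_k$, view $M$ and $f_M$ as bounded linear functionals on $C(V)$: $\langle M,\phi\rangle:=\int_M\phi\,d\mathcal{H}^k$ and $\langle f_M,\phi\rangle:=\int_M f_M\phi\,d\mathcal{H}^k$. This embeds $X_k$ into $(C(V))'\times(C(V))'$, and $X_k$ carries the induced metric $$d_{X_k}((M_1,f^1_{M_1}),(M_2,f^2_{M_2})):=\lVert M_1-M_2\rVert_{(C(V))'}+\lVert f^1_{M_1}-f^2_{M_2}\rVert_{(C(V))'}.$$ Continuity of $\mathcal{G}$ and compactness of $K$ are with respect to this metric. **$(r,s,t)$-convergence sequence.** Let $\kappa$ be a monotonically increasing function from positive integers to positive integers. $\{\phi_{n,m}\}_{1\le n,1\le m\le\kappa(n)}$ is an $(r,s,t)$-convergence sequence if $\phi_{n,m}\in C(V)\cap H^s(V)$, for each $n$ the functions $\phi_{n,1},\dots,\phi_{n,\kappa(n)}$ are linearly independent, and $$\sup_{\lVert\phi\rVert_{C^r(V)}\le1}\lVert\phi-\Pi_n^s\phi\rVert_{C(V)}=\mathcal{O}\left(\frac1{n^t}\right)\ (n\to\infty),\qquad \Pi_n^s\phi:=\operatorname*{arg\,min}_{v\in\operatorname{span}\{\phi_{n,m}\}_{m=1}^{\kappa(n)}}\lVert\phi-v\rVert_{H^s(V)},$$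 i.e. $\Pi_n^s$ is the $H^s$-orthogonal projection onto $\operatorname{span}\{\phi_{n,m}\}_{m=1}^{\kappa(n)}$. **Encoder.** For $(M,f_M)\in X_k$, $$\Phi_n(M,f_M):=\left(\left(\int_M\phi_{n,m}\,d\mathcal{H}^k\right)_{m=1}^{\kappa(n)},\left(\int_M f_M\,\phi_{n,m}\,d\mathcal{H}^k\right)_{m=1}^{\kappa(n)}\right)\in\mathbb{R}^{2\kappa(n)}.$$ *)

(* Defs.v *)
From HB Require Import structures.
From mathcomp Require Import all_boot all_order all_algebra.
From mathcomp Require Import all_classical all_reals all_analysis.

Set Implicit Arguments.
Unset Strict Implicit.
Unset Printing Implicit Defensive.

Import Order.TTheory GRing.Theory Num.Theory.
Import numFieldNormedType.Exports.

Local Open Scope classical_set_scope.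
Local Open Scope ring_scope.

(* [powerset_type T] is [T] with every subset declared measurable; on it,     *)
(* [mu_ext tau] is the outer measure obtained from the set function [tau] by  *)
(* coverings with arbitrary sets.                                             *)
Definition powerset_type (T : Type) : Type := T.

Section powerset_type.
Variable T : pointedType.
HB.instance Definition _ := Pointed.on (powerset_type T).
HB.instance Definition _ := @isMeasurable.Build default_measure_display
  (powerset_type T) (fun=> True) I (fun _ _ => I) (fun _ _ => I).
End powerset_type.

Section euclidean_space.
Variables (R : realType) (d : nat).
Local Notation E := 'rV[R]_d.

(* The library norm on ['rV[R]_d] is the maximum norm.                        *)
Definition euclid (x : E) : R := Num.sqrt (\sum_(i < d) x ord0 i ^+ 2).

Definition cube : set E := [set x | forall i, 0 <= x ord0 i <= 1].
Definition open_cube : set E := [set x | forall i, 0 < x ord0 i < 1].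

Definition sup_cube (f : E -> R) : \bar R :=
  ereal_sup [set `|f x|%:E | x in cube].

Definition in_C (f : E -> R) : Prop := {within cube, continuous f}.

End euclidean_space.
Arguments cube {R d}.
Arguments open_cube {R d}.

Section hausdorff_measure.
Variables (R : realType) (d : nat).
Local Notation E := 'rV[R]_d.
Local Notation P := (powerset_type E).
Local Open Scope ereal_scope.

(* Volume of the unit ball of R^k.                                            *)
Fixpoint ball_volume (k : nat) : R :=
  match k with
  | 0%N => 1%R
  | 1%N => 2%R
  | k'.+2 => (2 * pi / k'.+2%:R * ball_volume k')%R
  end.

Definition diameter (B : set E) : \bar R :=
  ereal_sup [set (euclid (xy.1 - xy.2))%:E | xy in B `*` B].

(* The value [+oo] excludes the sets of diameter larger than [delta] from the *)
(* coverings. For [k = 0] every nonempty set of small diameter counts for 1.  *)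
Definition hausdorff_gauge (k : nat) (delta : R) (B : set P) : \bar R :=
  if pselect (B = set0) then 0
  else if diameter B <= delta%:E
       then (ball_volume k)%:E * ((diameter B * (2^-1)%:E) ^+ k)
       else +oo.

Definition hausdorff (k : nat) (A : set E) : \bar R :=
  ereal_sup [set mu_ext (hausdorff_gauge k delta) A
            | delta in [set delta : R | (0 < delta)%R]].

Lemma ball_volume_ge0 k : (0 <= ball_volume k)%R.
Proof.
suff : (0 <= ball_volume k)%R /\ (0 <= ball_volume k.+1)%R by case.
elim: k => [|k [k0 k1]]; first by split => /=.
split => //=; rewrite !mulr_ge0 ?pi_ge0 ?invr_ge0 //.
Qed.

Lemma diameter_ge0 B : B !=set0 -> 0 <= diameter B.
Proof.
move=> [x Bx]; apply: ereal_sup_ubound; exists (x, x) => //=.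
rewrite subrr /euclid big1 ?sqrtr0// => i _; by rewrite mxE expr0n.
Qed.

Lemma hausdorff_gauge0 k delta : hausdorff_gauge k delta set0 = 0.
Proof. by rewrite /hausdorff_gauge; case: pselect. Qed.

Lemma hausdorff_gauge_ge0 k delta B : 0 <= hausdorff_gauge k delta B.
Proof.
rewrite /hausdorff_gauge; case: pselect => // B_neq0.
have B0 : B !=set0 by apply/set0P/eqP.
case: ifP => // _; rewrite mule_ge0 ?lee_fin ?ball_volume_ge0//.
by rewrite expe_ge0// mule_ge0 ?diameter_ge0// lee_fin invr_ge0.
Qed.

Lemma hausdorff0 k : hausdorff k set0 = 0.
Proof.
apply/eqP; rewrite eq_le; apply/andP; split.
  apply: ge_ereal_sup => _ [delta _ <-]; rewrite mu_ext0//.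
  - exact: hausdorff_gauge0.
  - exact: hausdorff_gauge_ge0.
apply: ereal_sup_ubound; exists 1%R => //=; rewrite mu_ext0//.
- exact: hausdorff_gauge0.
- exact: hausdorff_gauge_ge0.
Qed.

Lemma hausdorff_ge0 k A : 0 <= hausdorff k A.
Proof.
apply: le_trans (ereal_sup_ubound _); last by exists 1%R => //=.
by apply: mu_ext_ge0; exact: hausdorff_gauge_ge0.
Qed.

Lemma le_hausdorff k : {homo hausdorff k : A B / A `<=` B >-> A <= B}.
Proof.
move=> A B AB; apply: ge_ereal_sup => _ [delta delta0 <-].
apply: (@le_trans _ _ (mu_ext (hausdorff_gauge k delta) B)).
  exact: le_mu_ext.
by apply: ereal_sup_ubound; exists delta.
Qed.

Lemma hausdorff_sigma_subadditive k : sigma_subadditive (hausdorff k).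
Proof.
move=> F; apply: ge_ereal_sup => _ [delta delta0 <-].
apply: (@le_trans _ _ (\sum_(i <oo) mu_ext (hausdorff_gauge k delta) (F i))).
  by apply: mu_ext_sigma_subadditive; exact: hausdorff_gauge_ge0.
apply: lee_nneseries => i _.
  by move=> _; apply: mu_ext_ge0; exact: hausdorff_gauge_ge0.
by apply: ereal_sup_ubound; exists delta.
Qed.

HB.instance Definition _ k := isOuterMeasure.Build R E (hausdorff k)
  (hausdorff0 k) (hausdorff_ge0 k) (@le_hausdorff k)
  (@hausdorff_sigma_subadditive k).

Definition hausdorff_measure k :
  set (caratheodory_type (hausdorff k)) -> \bar R := hausdorff k.
Arguments hausdorff_measure : clear implicits.

HB.instance Definition _ k := isMeasure.Build _ _ _ (hausdorff_measure k)
  (@caratheodory_measure0 _ _ (hausdorff k)) (@caratheodory_measure_ge0 _ _ (hausdorff k))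
  (@caratheodory_measure_sigma_additive _ _ (hausdorff k)).

End hausdorff_measure.
Arguments hausdorff {R d}.
Arguments hausdorff_measure {R d}.

Section lebesgue_measure.
Variables (R : realType) (d : nat).
Local Notation E := 'rV[R]_d.
Local Notation P := (powerset_type E).
Local Open Scope ereal_scope.

Definition box (a b : E) : set E :=
  [set x | forall i, (a ord0 i <= x ord0 i <= b ord0 i)%R].

(* The volume of a closed box, [0] at the empty set, and [+oo], the infimum   *)
(* of the empty set, at any other set.                                        *)
Definition box_volume (B : set P) : \bar R :=
  if pselect (B = set0) then 0
  else ereal_inf
    [set (\prod_(i < d) (ab.2 ord0 i - ab.1 ord0 i))%:E
    | ab in [set ab : E * E | (forall i, (ab.1 ord0 i <= ab.2 ord0 i)%R)
                              /\ B = box ab.1 ab.2]].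

Definition lebesgue_outer : set E -> \bar R := mu_ext box_volume.

Lemma box_volume0 : box_volume set0 = 0.
Proof. by rewrite /box_volume; case: pselect. Qed.

Lemma box_volume_ge0 B : 0 <= box_volume B.
Proof.
rewrite /box_volume; case: pselect => // B_neq0.
apply: le_ereal_inf_tmp => _ [ab [ab_le _] <-].
by rewrite lee_fin; apply: prodr_ge0 => i _; rewrite subr_ge0.
Qed.

HB.instance Definition _ := isOuterMeasure.Build R E lebesgue_outer
  (mu_ext0 box_volume0 box_volume_ge0) (mu_ext_ge0 box_volume_ge0)
  (le_mu_ext box_volume) (mu_ext_sigma_subadditive box_volume_ge0).

Definition lebesgue :
  set (caratheodory_type lebesgue_outer) -> \bar R := lebesgue_outer.
Arguments lebesgue : clear implicits.

HB.instance Definition _ := isMeasure.Build _ _ _ lebesgue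
  (@caratheodory_measure0 _ _ lebesgue_outer)
  (@caratheodory_measure_ge0 _ _ lebesgue_outer)
  (@caratheodory_measure_sigma_additive _ _ lebesgue_outer).

End lebesgue_measure.
Arguments lebesgue_outer {R d}.
Arguments lebesgue {R d}.

Section Cr_space.
Variables (R : realType) (d : nat).
Local Notation E := 'rV[R]_d.

(* [partial [:: i1; ...; im] f] is the iterated partial derivative            *)
(* [d_i1 (... (d_im f))].                                                     *)
Definition partial (l : seq 'I_d) (f : E -> R) : E -> R :=
  foldr (fun i g x => 'D_(delta_mx ord0 i) g x) f l.

(* Derivatives are taken in the open cube, and have to extend continuously to *)
(* the closed one.                                                            *)
Definition in_Cr (r : nat) (f : E -> R) : Prop :=
  [/\ in_C f,
      forall (l : seq 'I_d) (i : 'I_d) (x : E), (size l < r)%N ->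
        open_cube x -> derivable (partial l f) x (delta_mx ord0 i)
    & forall l : seq 'I_d, (size l <= r)%N ->
        exists2 g, in_C g & forall x, open_cube x -> g x = partial l f x].

Definition Cr_norm (r : nat) (f : E -> R) : \bar R :=
  ereal_sup [set `|partial lx.1 f lx.2|%:E
            | lx in [set l : seq 'I_d | (size l <= r)%N] `*` open_cube].

End Cr_space.

Section Hs_space.
Variables (R : realType) (d : nat).
Local Notation E := 'rV[R]_d.

Definition L2_cube (f : E -> R) : Prop :=
  ((f \_ cube : caratheodory_type lebesgue_outer -> R)
     \in Lfun lebesgue 2%:E).

Definition test_function (psi : E -> R) : Prop :=
  [/\ forall (l : seq 'I_d), continuous (partial l psi),
      forall (l : seq 'I_d) (i : 'I_d) (x : E),
        derivable (partial l psi) x (delta_mx ord0 i)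
    & exists C : set E, [/\ compact C, C `<=` open_cube
                          & forall x, ~ C x -> psi x = 0]].

Definition is_weak_partial (l : seq 'I_d) (f g : E -> R) : Prop :=
  L2_cube g /\ forall psi, test_function psi ->
    \int[lebesgue]_(x in cube) (f x * partial l psi x) =
    (-1) ^+ size l * \int[lebesgue]_(x in cube) (g x * psi x).

(* A weak derivative is unique up to a null set; this picks one of them.      *)
Definition weak_partial (l : seq 'I_d) (f : E -> R) : E -> R :=
  get (is_weak_partial l f).

(* Multi-indices with entries at most [m], and the corresponding lists of     *)
(* directions.                                                                *)
Local Notation multi_index m := {ffun 'I_d -> 'I_m.+1}.
Definition multi_size m (alpha : multi_index m) : nat := \sum_i alpha i.
Definition multi_seq m (alpha : multi_index m) : seq 'I_d :=
  flatten [seq nseq (alpha i) i | i <- enum 'I_d].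

Definition in_Hm (m : nat) (f : E -> R) : Prop :=
  L2_cube f /\ forall alpha : multi_index m, (multi_size alpha <= m)%N ->
    exists g, is_weak_partial (multi_seq alpha) f g.

(* The integer part of the squared norm, and the square of the Gagliardo      *)
(* seminorm of order [theta].                                                 *)
Definition Hm_sqnorm (m : nat) (f : E -> R) : \bar R :=
  (\sum_(alpha : multi_index m | (multi_size alpha <= m)%N)
    \int[lebesgue]_(x in cube)
      ((weak_partial (multi_seq alpha) f x) ^+ 2)%:E)%E.

Definition gagliardo (theta : R) (g : E -> R) : \bar R :=
  (\int[lebesgue]_(x in cube) \int[lebesgue]_(y in cube)
    ((g x - g y) ^+ 2 / euclid (x - y) `^ (d%:R + 2 * theta))%:E)%E.

(* The Sobolev-Slobodeckij space and its norm for real [s >= 0], where        *)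
(* [s = m + theta] with [m] an integer and [0 <= theta < 1].                  *)
Definition Hs_sqnorm (s : R) (f : E -> R) : \bar R :=
  let m := Num.truncn s in
  let theta := s - m%:R in
  (Hm_sqnorm m f +
   (if theta == 0%R then 0
    else \sum_(alpha : multi_index m | multi_size alpha == m)
           gagliardo theta (weak_partial (multi_seq alpha) f)))%E.

Definition in_Hs (s : R) (f : E -> R) : Prop :=
  in_Hm (Num.truncn s) f /\ (Hs_sqnorm s f < +oo)%E.

Definition Hs_norm (s : R) (f : E -> R) : \bar R :=
  (Hs_sqnorm s f `^ 2^-1)%E.

End Hs_space.

Section convergence_sequence.
Variables (R : realType) (d : nat) (kappa : nat -> nat).
Local Notation E := 'rV[R]_d.
(* [phi n m] stands for the function of index [(n, m + 1)], for [n >= 1].     *)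
Variable phi : forall n, 'I_(kappa n) -> E -> R.

Definition phi_span (n : nat) : set (E -> R) :=
  [set v | exists c : 'I_(kappa n) -> R,
    v = fun x => \sum_(m < kappa n) c m * phi m x].

Definition lin_indep (n : nat) : Prop :=
  forall c : 'I_(kappa n) -> R,
    (forall x, cube x -> \sum_(m < kappa n) c m * phi m x = 0) ->
    forall m, c m = 0.

Definition is_argmin (s : R) (S : set (E -> R)) (f v : E -> R) : Prop :=
  S v /\ forall w, S w -> (Hs_norm s (f \- v)%R <= Hs_norm s (f \- w)%R)%E.

(* [Pi n] is the projection onto [phi_span n]; on the cube it is determined by *)
(* the [is_argmin] condition, the functions [phi n m] being independent.      *)
Definition convergence_sequence (r : nat) (s t : R) : Prop :=
  [/\ forall n (m : 'I_(kappa n)), (0 < n)%N -> in_C (phi m) /\ in_Hs s (phi m),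
      forall n, (0 < n)%N -> lin_indep n
    & exists Pi : nat -> (E -> R) -> E -> R,
        (forall n f, (0 < n)%N -> in_Cr r f ->
           is_argmin s (phi_span n) f (Pi n f)) /\
        exists (C : R) (N : nat), forall n, (0 < n)%N -> (N <= n)%N ->
          (ereal_sup [set sup_cube (f \- Pi n f)%R
                     | f in [set f | in_Cr r f /\ (Cr_norm r f <= 1)%E]]
             <= (C * (1 / n%:R `^ t))%:E)%E].

End convergence_sequence.

Definition increasing_positive (kappa : nat -> nat) : Prop :=
  (forall n, (0 < n)%N -> (0 < kappa n)%N) /\
  (forall m n, (0 < m)%N -> (m <= n)%N -> (kappa m <= kappa n)%N).

Section manifolds.
Variables (R : realType) (d : nat).
Local Notation E := 'rV[R]_d.

(* First coordinate nonnegative; the whole (one-point) space for [k = 0].     *)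
Definition half_space (k : nat) : set 'rV[R]_k :=
  [set x | forall i : 'I_k, i = 0%N :> nat -> 0 <= x ord0 i].

Definition lipschitz_manifold (k : nat) (M : set E) : Prop :=
  forall p, M p -> exists (U : set E) (O : set 'rV[R]_k) (h : E -> 'rV[R]_k),
    [/\ open U, U p, open O,
        h @` (M `&` U) = @half_space k `&` O
      & exists2 L : R, 0 < L & forall x y, (M `&` U) x -> (M `&` U) y ->
          euclid (x - y) <= L * euclid (h x - h y) /\
          euclid (h x - h y) <= L * euclid (x - y)].

Definition topological_manifold (k : nat) (M : set E) : Prop :=
  forall p, M p -> exists (U : set E) (O : set 'rV[R]_k)
                          (h : E -> 'rV[R]_k) (g : 'rV[R]_k -> E),
    [/\ open U, U p, open O,
        h @` (M `&` U) = @half_space k `&` O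
      & [/\ {within M `&` U, continuous h},
            {within @half_space k `&` O, continuous g}
          & forall x, (M `&` U) x -> g (h x) = x]].

Definition manifold_union (k : nat) (M : set E) : Prop :=
  exists (m : nat) (A : 'I_m -> set E),
    [/\ (0 < m)%N,
        forall i, [/\ compact (A i), A i `<=` cube,
                      lipschitz_manifold k (A i)
                    & (hausdorff k (A i) < +oo)%E],
        forall i j, i != j -> A i `&` A j = set0 \/
          exists2 l, (l < k)%N & topological_manifold l (A i `&` A j)
      & M = \bigcup_i A i].

End manifolds.

(* Elements of [X_k]. The values of [density] outside [carrier] are           *)
(* irrelevant, and so are those on null sets: classes in L^2 are handled by   *)
(* means of representatives, two of which are at distance [0].                *)
Record manifold_function (R : realType) (d k : nat) := ManifoldFunction {
  carrier : set 'rV[R]_d ;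
  density : 'rV[R]_d -> R ;
  carrierP : manifold_union k carrier ;
  densityP : ((density \_ carrier : caratheodory_type (hausdorff k) -> R)
                \in Lfun (hausdorff_measure k) 2%:E)
}.

Section metric.
Variables (R : realType) (d k : nat).
Local Notation E := 'rV[R]_d.
Local Notation X := (manifold_function R d k).
Local Open Scope ereal_scope.

Definition carrier_dual (x : X) (f : E -> R) : R :=
  (\int[hausdorff_measure k]_(z in carrier x) f z)%R.

Definition density_dual (x : X) (f : E -> R) : R :=
  (\int[hausdorff_measure k]_(z in carrier x) (density x z * f z))%R.

Definition dual_norm (F : (E -> R) -> R) : \bar R :=
  ereal_sup [set `|F f|%:E | f in [set f | in_C f /\ sup_cube f <= 1]].

Definition mf_dist (x y : X) : \bar R :=
  dual_norm (fun f => carrier_dual x f - carrier_dual y f)%R +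
  dual_norm (fun f => density_dual x f - density_dual y f)%R.

Definition mf_ball (x : X) (e : R) (y : X) : Prop := mf_dist x y < e%:E.

Lemma dual_norm_ge0 F : 0 <= dual_norm F.
Proof.
apply: le_trans (ereal_sup_ubound _); last first.
  exists (fun=> 0%R); last by []; split.
    by move=> x; exact: cst_continuous.
  by apply: ge_ereal_sup => _ [x _ <-]; rewrite normr0 lee_fin.
by rewrite lee_fin.
Qed.

Lemma dual_norm_sym (a b : (E -> R) -> R) :
  dual_norm (fun f => a f - b f)%R = dual_norm (fun f => b f - a f)%R.
Proof. by congr ereal_sup; apply: eq_imagel => f _; rewrite distrC. Qed.

Lemma dual_norm_triangle (a b c : (E -> R) -> R) :
  dual_norm (fun f => a f - c f)%R <=
  dual_norm (fun f => a f - b f)%R + dual_norm (fun f => b f - c f)%R.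
Proof.
apply: ge_ereal_sup => _ [f Bf <-].
apply: (@le_trans _ _ (`|a f - b f|%:E + `|b f - c f|%:E)).
  by rewrite -EFinD lee_fin ler_distD.
by apply: leeD; apply: ereal_sup_ubound; exists f.
Qed.

Lemma mf_ball_center x (e : R) : (0 < e)%R -> mf_ball x e x.
Proof.
move=> e0; rewrite /mf_ball /mf_dist.
suff d0 (a : (E -> R) -> R) : dual_norm (fun f => a f - a f)%R = 0.
  by rewrite !d0 adde0 lte_fin.
apply/eqP; rewrite eq_le dual_norm_ge0 andbT.
by apply: ge_ereal_sup => _ [f _ <-]; rewrite subrr normr0.
Qed.

Lemma mf_ball_sym x y (e : R) : mf_ball x e y -> mf_ball y e x.
Proof.
by rewrite /mf_ball /mf_dist dual_norm_sym [X in _ + X]dual_norm_sym.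
Qed.

Lemma mf_ball_triangle x y z (e1 e2 : R) :
  mf_ball x e1 y -> mf_ball y e2 z -> mf_ball x (e1 + e2) z.
Proof.
rewrite /mf_ball /mf_dist EFinD => xy yz; apply: le_lt_trans (lteD xy yz).
by rewrite addeACA; apply: leeD; exact: dual_norm_triangle.
Qed.

HB.instance Definition _ := gen_eqMixin X.
HB.instance Definition _ := gen_choiceMixin X.
HB.instance Definition _ := hasNbhs.Build X (nbhs_ (entourage_ mf_ball)).
HB.instance Definition _ := @Nbhs_isPseudoMetric.Build R X
  (entourage_ mf_ball) erefl mf_ball mf_ball_center mf_ball_sym
  mf_ball_triangle erefl.

Definition encoder (kappa : nat -> nat)
    (phi : forall n, 'I_(kappa n) -> E -> R) (n : nat) (x : X) :
    'rV[R]_(kappa n + kappa n) :=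
  row_mx (\row_m carrier_dual x (phi n m)) (\row_m density_dual x (phi n m)).

End metric.

(* Main.v *)
Require Import Defs.
From HB Require Import structures.
From mathcomp Require Import all_boot all_order all_algebra.
From mathcomp Require Import all_classical all_reals all_analysis.
From mathcomp Require Import measurable_realfun ring lra.

Set Implicit Arguments.
Unset Strict Implicit.
Unset Printing Implicit Defensive.

Import Order.TTheory GRing.Theory Num.Theory.
Import numFieldNormedType.Exports.

Local Open Scope classical_set_scope.
Local Open Scope ring_scope.

(** Why the theorem holds.

    An encoder [Phi_n] is continuous, but a single one is far from injective. The
    point is that, given [eps], some [Phi_q] is injective enough for [G]: equality
    of [Phi_q x] and [Phi_q y] forces [`|G x - G y| < eps]. Two elements [x] and
    [y] of [X_k] at positive distance are distinguished by a continuous function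
    [f], that is [<x, f> <> <y, f>] for one of the two components. Polynomials are
    dense in [C(V)] ([poly_dense]) and, after scaling, belong to the unit ball of
    [C^r(V)], so the convergence property provides, for all large [n], functions
    of the [n]-th span that are uniformly close to [f] ([span_dense]). These
    distinguish all pairs in a neighbourhood of [(x, y)] as well, hence so do the
    encoders [Phi_n] for [n] large ([encoder_separates]). A pair at distance [0] has
    a neighbourhood on which [G] varies little. By compactness of [K `*` K],
    finitely many such neighbourhoods suffice, and a single [q] serves all pairs.

    Compactness again turns this implication into a uniform one: for some
    [delta > 0], [`|Phi_q x - Phi_q y| < delta] implies [`|G x - G y| < eps]
    ([separated_modulus]). Then [G] is approximated by a weighted mean of finitely
    many of its values, where the weights form a partition of unity on the image
    of [Phi_q] ([finite_factorization]): the weights are the components of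
    [Gt], and [u] is the linear map sending a weight vector to the mean.

    That [x] acts on [C(V)] as a bounded linear functional rests on measure
    theory: continuous functions have to be measurable for the sigma-algebra of
    the Caratheodory measurable sets of Hausdorff measure. This follows from
    [closed_caratheodory], which holds because Hausdorff measure is additive on
    sets at positive distance ([hausdorff_separated]). *)

(** * Bernstein weights and polynomial functions *)

Section bernstein.
Variable R : realType.
Implicit Types (u : R) (g : nat -> R).

Definition bernstein_weight n u j : R :=
  'C(n, j)%:R * (u ^+ j * (1 - u) ^+ (n - j)).

Definition bernstein_mean n u g : R :=
  \sum_(j < n.+1) bernstein_weight n u j * g j.

(** Pascal's rule: conditioning on the first of [n + 1] coin tosses. All moments
    follow from this recursion by induction on [n]. *)
Lemma bernstein_meanS n u g :
  bernstein_mean n.+1 u g =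
  u * bernstein_mean n u (fun j => g j.+1) + (1 - u) * bernstein_mean n u g.
Proof.
rewrite /bernstein_mean big_ord_recl.
under eq_bigr => j _.
  rewrite /bernstein_weight lift0 binS natrD exprS subSS mulrDl mulrDl.
  over.
rewrite big_split /= addrA addrC; congr (_ + _).
  by rewrite big_distrr/=; apply: eq_bigr => j _; rewrite /bernstein_weight; ring.
rewrite big_ord_recr/= bin_small// !mul0r addr0.
rewrite [in RHS]big_ord_recl/= mulrDr big_distrr/=; congr (_ + _).
  by rewrite /bernstein_weight !bin0 !subn0 expr0 exprS; ring.
apply: eq_bigr => j _; rewrite /bernstein_weight /bump/= ?add1n.
have -> : (n - j = (n - j.+1).+1)%N by rewrite subnSK.
by rewrite !exprS; ring.
Qed.

Lemma bernstein_meanD n u g h :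
  bernstein_mean n u (fun j => g j + h j) =
  bernstein_mean n u g + bernstein_mean n u h.
Proof.
by rewrite /bernstein_mean -big_split; apply: eq_bigr => j _; rewrite mulrDr.
Qed.

Lemma bernstein_meanZ n u (a : R) g :
  bernstein_mean n u (fun j => a * g j) = a * bernstein_mean n u g.
Proof.
by rewrite /bernstein_mean big_distrr/=; apply: eq_bigr => j _; ring.
Qed.

Lemma bernstein_mean1 n u : bernstein_mean n u (fun=> 1) = 1.
Proof.
elim: n => [|n IH]; last by rewrite bernstein_meanS IH; ring.
by rewrite /bernstein_mean big_ord1 /bernstein_weight bin0 subnn; ring.
Qed.

Lemma bernstein_mean_id n u : bernstein_mean n u (fun j => j%:R) = n%:R * u.
Proof.
elim: n => [|n IH].
  by rewrite /bernstein_mean big_ord1/= mulr0 mul0r.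
rewrite bernstein_meanS.
have -> : (fun j => j.+1%:R) = (fun j => j%:R + 1) :> (nat -> R).
  by apply/funext => j; rewrite -natr1.
by rewrite bernstein_meanD bernstein_mean1 IH -natr1; ring.
Qed.

(** [bernstein_mean n u] is the mean under the binomial law with parameters [n] and
    [u]. The two auxiliary identities express the squares for [n + 1] tosses
    through the moments of order at most 2 for [n] tosses. *)
Lemma bernstein_variance n u :
  bernstein_mean n u (fun j => (j%:R - n%:R * u) ^+ 2) = n%:R * (u * (1 - u)).
Proof.
elim: n => [|n IH].
  by rewrite /bernstein_mean big_ord1/= !mul0r subrr expr0n mulr0.
rewrite bernstein_meanS.
have -> : (fun j => (j.+1%:R - n.+1%:R * u) ^+ 2) = (fun j =>
    (j%:R - n%:R * u) ^+ 2 + ((2 * (1 - u)) * j%:R +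
     ((1 - u) ^+ 2 - 2 * (1 - u) * n%:R * u) * 1)) :> (nat -> R).
  by apply/funext => j; rewrite -!natr1; ring.
have -> : (fun j => (j%:R - n.+1%:R * u) ^+ 2) = (fun j =>
    (j%:R - n%:R * u) ^+ 2 + ((- 2 * u) * j%:R +
     (u ^+ 2 + 2 * n%:R * u ^+ 2) * 1)) :> (nat -> R).
  by apply/funext => j; rewrite -!natr1; ring.
rewrite !bernstein_meanD !bernstein_meanZ IH bernstein_mean1 bernstein_mean_id.
by rewrite -natr1; ring.
Qed.

Lemma bernstein_weight_ge0 n u j : 0 <= u <= 1 -> 0 <= bernstein_weight n u j.
Proof.
move=> /andP[u0 u1]; rewrite /bernstein_weight !mulr_ge0 ?ler0n ?exprn_ge0//.
by rewrite subr_ge0.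
Qed.

End bernstein.

Section polynomials.
Variables (R : realType) (d : nat).
Local Notation E := 'rV[R]_d.
Implicit Types (f g : E -> R).

(** Polynomials are kept as functions, because the partial derivatives to be
    controlled are those of functions. *)
Inductive poly_fun : (E -> R) -> Prop :=
| poly_cst c : poly_fun (fun=> c)
| poly_coord i : poly_fun (fun x => x ord0 i)
| poly_add f g : poly_fun f -> poly_fun g -> poly_fun (fun x => f x + g x)
| poly_mul f g : poly_fun f -> poly_fun g -> poly_fun (fun x => f x * g x).

Lemma poly_sum (I : Type) (s : seq I) (F : I -> E -> R) :
  (forall i, poly_fun (F i)) -> poly_fun (fun x => \sum_(i <- s) F i x).
Proof.
move=> pF; elim: s => [|i s IH].
  by under eq_fun do rewrite big_nil; exact: poly_cst.
by under eq_fun do rewrite big_cons; exact: poly_add.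
Qed.

Lemma poly_prod (I : Type) (s : seq I) (F : I -> E -> R) :
  (forall i, poly_fun (F i)) -> poly_fun (fun x => \prod_(i <- s) F i x).
Proof.
move=> pF; elim: s => [|i s IH].
  by under eq_fun do rewrite big_nil; exact: poly_cst.
by under eq_fun do rewrite big_cons; exact: poly_mul.
Qed.

Lemma poly_exp f n : poly_fun f -> poly_fun (fun x => f x ^+ n).
Proof.
move=> pf; elim: n => [|n IH].
  by under eq_fun do rewrite expr0; exact: poly_cst.
by under eq_fun do rewrite exprS; exact: poly_mul.
Qed.

Lemma poly_continuous f : poly_fun f -> continuous f.
Proof.
elim=> [c|i|{}f g _ cf _ cg|{}f g _ cf _ cg] x.
- exact: cst_continuous.
- exact: coord_continuous.
- by apply: continuousD; [exact: cf|exact: cg].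
- by apply: continuousM; [exact: cf|exact: cg].
Qed.

Lemma poly_derivable f v x : poly_fun f -> derivable f x v.
Proof.
elim=> [c|i|{}f g _ df _ dg|{}f g _ df _ dg].
- exact: derivable_cst.
- by apply: diff_derivable; exact: differentiable_coord.
- exact: derivableD.
- exact: derivableM.
Qed.

Lemma poly_derive f v : poly_fun f -> poly_fun (fun x => 'D_v f x).
Proof.
elim=> [c|i|{}f g pf df pg dg|{}f g pf df pg dg].
- under eq_fun do rewrite derive_cst; exact: poly_cst.
- suff -> : (fun x : E => 'D_v (fun y : E => y ord0 i) x) = (fun=> v ord0 i).
    exact: poly_cst.
  apply/funext => x; apply: derive_val; apply: DeriveDef.
    by apply: poly_derivable; exact: poly_coord.
  rewrite /derive; apply: lim_near_cst => //.
  near=> h; rewrite /= !mxE addrK scalerA mulVf ?scale1r//.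
  by near: h; exact: nbhs_dnbhs_neq.
- suff -> : (fun x => 'D_v (fun y => f y + g y) x) =
            (fun x => 'D_v f x + 'D_v g x) by exact: poly_add.
  by apply/funext => x; rewrite deriveD//; exact: poly_derivable.
- suff -> : (fun x => 'D_v (fun y => f y * g y) x) =
            (fun x => f x * 'D_v g x + g x * 'D_v f x).
    by apply: poly_add; exact: poly_mul.
  by apply/funext => x; rewrite deriveM//; exact: poly_derivable.
Unshelve. all: by end_near. Qed.

Lemma poly_partial l f : poly_fun f -> poly_fun (partial l f).
Proof. by move=> pf; elim: l => //= i l; exact: poly_derive. Qed.

Lemma partialZ l f (c : R) : poly_fun f ->
  partial l (fun x => c * f x) = (fun x => c * partial l f x).
Proof.
move=> pf; elim: l => //= i l ->; apply/funext => x.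
by rewrite deriveMl//; apply: poly_derivable; exact: poly_partial.
Qed.

End polynomials.

(** * Density of polynomials in the continuous functions on the cube *)

Section cube_functions.
Variables (R : realType) (d : nat).
Local Notation E := 'rV[R]_d.
Implicit Types (f g : E -> R) (x y : E).

Lemma row_norm_le n (x : 'rV[R]_n) (e : R) : 0 <= e ->
  (`|x| <= e) = [forall i, `|x ord0 i| <= e].
Proof.
move=> e0; rewrite /Num.norm/= mx_normrE; apply/idP/forallP => [xe i|xe].
  exact: le_trans (le_bigmax _ (fun ij : 'I_1 * 'I_n => `|x ij.1 ij.2|) (ord0, i)) xe.
by apply: bigmax_le => // -[a i] _ /=; rewrite (ord1 a); exact: xe.
Qed.

Lemma row_norm_lt n (x : 'rV[R]_n) (e : R) : 0 < e ->
  (forall i, `|x ord0 i| < e) -> `|x| < e.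
Proof.
move=> e0 xe; rewrite /Num.norm/= mx_normrE.
by apply: bigmax_lt => // -[a i] _ /=; rewrite (ord1 a); exact: xe.
Qed.

Lemma row_continuous (S : topologicalType) n (h : S -> 'rV[R]_n) :
  (forall j, continuous (fun w => h w ord0 j)) -> continuous h.
Proof.
move=> ch w; apply/cvgrPdist_lt => e e0.
have : \forall w' \near w, forall j, `|h w ord0 j - h w' ord0 j| < e.
  by apply: filter_forall => j; exact: (cvgrPdist_lt _ _).1 (ch j w) e e0.
apply: filterS => w' hw'; apply: row_norm_lt => // j.
by rewrite !mxE.
Qed.

Lemma cube_compact : compact (@cube R d).
Proof.
have -> : @cube R d = [set v | forall i, `[0, 1]%classic (v ord0 i)].
  by apply/seteqP; split => x xc i; have := xc i; rewrite /= in_itv.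
by apply: (@rV_compact R d (fun=> `[0, 1]%classic)) => i; exact: segment_compact.
Qed.

Lemma in_CP f : in_C f <-> forall x, cube x -> forall e, 0 < e ->
  \forall y \near x, cube y -> `|f x - f y| < e.
Proof.
rewrite /in_C subspace_continuousP; split.
  move=> fc x cx e e0.
  have /cvgrPdist_lt/(_ e e0) := fc x cx.
  by rewrite near_withinE.
move=> fc x cx; apply/cvgrPdist_lt => e e0; rewrite near_withinE.
exact: fc.
Qed.

Lemma poly_in_C f : poly_fun f -> in_C f.
Proof. by move=> pf; apply: continuous_subspaceT; exact: poly_continuous. Qed.

Lemma in_CD f g : in_C f -> in_C g -> in_C (fun x => f x + g x).
Proof. by move=> cf cg x; apply: continuousD; [exact: cf|exact: cg]. Qed.

Lemma in_CZ (c : R) f : in_C f -> in_C (fun x => c * f x).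
Proof.
by move=> cf x; apply: continuousM; [exact: cst_continuous|exact: cf].
Qed.

Lemma in_CB f g : in_C f -> in_C g -> in_C (f \- g).
Proof.
by move=> cf cg x; apply: continuousB; [exact: cf|exact: cg].
Qed.

Lemma in_C_sum (I : Type) (s : seq I) (F : I -> E -> R) :
  (forall i, in_C (F i)) -> in_C (fun x => \sum_(i <- s) F i x).
Proof.
move=> cF; elim: s => [|i s IH].
  by under eq_fun do rewrite big_nil; apply: poly_in_C; exact: poly_cst.
by under eq_fun do rewrite big_cons; exact: in_CD.
Qed.

Lemma in_C_bounded f : in_C f ->
  exists2 B : R, 0 < B & forall x, cube x -> `|f x| <= B.
Proof.
move=> /in_CP fc.
have : \forall B \near +oo, @cube R d `<=` [set x | `|f x| <= B].
  have /compact_near_coveringP/near_covering_withinP := cube_compact.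
  apply => x cx; near=> y B => /= cy.
  have fxy : `|f x - f y| < 1 by apply: (near (fc x cx 1 ltr01) y).
  have : `|f x| + 1 <= B by near: B; exact: nbhs_pinfty_ge.
  by apply: le_trans; have := lerB_dist (f y) (f x); rewrite distrC; lra.
move=> H; have [B [BP B0]] : exists B, @cube R d `<=` [set x | `|f x| <= B] /\ 0 < B.
  apply: (@filter_ex _ (+oo : set_system R)); near=> B; split; first by near: B.
  by near: B; exact: nbhs_pinfty_gt.
by exists B.
Unshelve. all: by end_near. Qed.

Lemma in_C_uniform f (e : R) : in_C f -> 0 < e ->
  exists2 dl : R, 0 < dl & forall x y, cube x -> cube y -> `|x - y| < dl ->
    `|f x - f y| < e.
Proof.
move=> /in_CP fc e0.
have : \forall dl \near 0^'+, @cube R d `<=`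
    [set x | forall y, cube y -> `|x - y| < dl -> `|f x - f y| < e].
  have /compact_near_coveringP/near_covering_withinP := cube_compact.
  apply => x cx.
  have e20 : 0 < e / 2 by rewrite divr_gt0.
  have /nbhs_ballP[r /= r0 rP] := fc x cx _ e20.
  have r20 : 0 < r / 2 by rewrite divr_gt0.
  near=> x' dl => cx' y cy /= x'y.
  have xx' : `|x - x'| < r / 2.
    suff : ball x (r / 2) x' by rewrite -ball_normE.
    exact: (near (nbhsx_ballx x _ r20) x').
  have dlr : dl < r / 2 by near: dl; apply: nbhs_right_lt; rewrite divr_gt0.
  have fxx' : `|f x - f x'| < e / 2.
    by apply: rP => //; rewrite -ball_normE /ball_/=; lra.
  have fxy : `|f x - f y| < e / 2.
    apply: rP => //; rewrite -ball_normE /ball_/=.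
    by have := ler_distD x' x y; lra.
  by have := ler_distD (f x) (f x') (f y); rewrite (distrC (f x') (f x)); lra.
move=> H; have [dl [dlP dl0]] : exists dl, @cube R d `<=`
    [set x | forall y, cube y -> `|x - y| < dl -> `|f x - f y| < e] /\ 0 < dl.
  apply: (@filter_ex _ (0^'+ : set_system R)); near=> dl; split; first by near: dl.
  by near: dl; exact: nbhs_right_gt.
by exists dl => // x y cx cy; exact: dlP.
Unshelve. all: by end_near. Qed.

(** Independence: the mean of a product over the coordinates is the product of
    the means. *)
Lemma tensor_bernstein_mean n x (h : 'I_d -> nat -> R) :
  \sum_(j : {ffun 'I_d -> 'I_n.+1})
     (\prod_i bernstein_weight n (x ord0 i) (j i)) * \prod_i h i (j i) =
  \prod_i bernstein_mean n (x ord0 i) (h i).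
Proof.
rewrite /bernstein_mean bigA_distr_bigA/=; apply: eq_bigr => j _.
by rewrite -big_split.
Qed.

(** Bernstein's proof in several variables. The value at [x] of the approximating
    polynomial is the mean of [f] over the grid points [j / n], where the [j i]
    are independent binomial variables with parameters [n] and [x i]. By the
    variance estimate the grid point is close to [x] with high probability, and
    uniform continuity then controls the error. *)
Lemma poly_dense f (e : R) : in_C f -> 0 < e ->
  exists2 p, poly_fun p & forall x, cube x -> `|f x - p x| <= e.
Proof.
move=> fc e0.
have e20 : 0 < e / 2 by rewrite divr_gt0.
have [dl dl0 dlP] := in_C_uniform fc e20.
have [B B0 BP] := in_C_bounded fc.
have [n n0 nP] : exists2 n, (0 < n)%N &
    2 * B * d%:R / dl ^+ 2 / n%:R <= e / 2.
  pose b : R := 2 * B * d%:R / dl ^+ 2 / (e / 2).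
  have b0 : 0 <= b by rewrite /b !divr_ge0 ?mulr_ge0 ?exprn_ge0 ?ler0n ?(ltW B0) ?(ltW dl0) ?(ltW e0).
  exists (Num.truncn b).+1 => //; rewrite ler_pdivrMr ?ltr0n// [leRHS]mulrC -ler_pdivrMr//.
  exact/ltW/truncnS_gt.
have nR0 : 0 < n%:R :> R by rewrite ltr0n.
pose grid (j : {ffun 'I_d -> 'I_n.+1}) : E := \row_i ((j i)%:R / n%:R).
pose W x (j : {ffun 'I_d -> 'I_n.+1}) :=
  \prod_i bernstein_weight n (x ord0 i) (j i).
have cgrid j : cube (grid j).
  move=> i; rewrite mxE divr_ge0//= ler_pdivrMr// mul1r ler_nat.
  by rewrite -ltnS.
exists (fun x => \sum_j f (grid j) * W x j).
  apply: poly_sum => j; apply: poly_mul; first exact: poly_cst.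
  apply: poly_prod => i; rewrite /bernstein_weight.
  apply: poly_mul; first exact: poly_cst.
  apply: poly_mul; first by apply: poly_exp; exact: poly_coord.
  apply: poly_exp; under eq_fun do rewrite -mulN1r.
  apply: poly_add; first exact: poly_cst.
  by apply: poly_mul; [exact: poly_cst|exact: poly_coord].
move=> x cx.
have W0 j : 0 <= W x j.
  by apply: prodr_ge0 => i _; exact: bernstein_weight_ge0.
have W1 : \sum_j W x j = 1.
  transitivity (\prod_i bernstein_mean n (x ord0 i) (fun=> 1)).
    rewrite -(tensor_bernstein_mean n x (fun _ _ => 1)).
    by apply: eq_bigr => j _; rewrite [X in _ * X]big1 ?mulr1.
  by rewrite big1// => i _; exact: bernstein_mean1.
(* Chebyshev's trick: with this constant the quadratic term exceeds the trivial
   bound [2 * B] as soon as some coordinate of [x - grid j] reaches [dl]. *)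
pose c := 2 * B / (dl * n%:R) ^+ 2.
have c0 : 0 <= c by rewrite /c divr_ge0 ?exprn_ge0// mulr_ge0// ltW.
have dist j : `|f x - f (grid j)| <=
    e / 2 + c * \sum_i ((j i)%:R - n%:R * x ord0 i) ^+ 2.
  have sq0 i : 0 <= c * ((j i)%:R - n%:R * x ord0 i) ^+ 2.
    by rewrite mulr_ge0// sqr_ge0.
  have [xj|] := ltP `|x - grid j| dl.
    rewrite (le_trans (ltW (dlP _ _ cx (cgrid j) xj)))// lerDl big_distrr/=.
    exact: sumr_ge0.
  rewrite leNgt => xj.
  have [i ij] : exists i, dl <= `|(x - grid j) ord0 i|.
    apply: contrapT => /forallNP xj'; move: xj; apply/negP; rewrite negbK.
    apply: row_norm_lt => // i; rewrite ltNge; apply/negP; exact: xj'.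
  have ijn : (dl * n%:R) ^+ 2 <= ((j i)%:R - n%:R * x ord0 i) ^+ 2.
    rewrite -[leRHS]real_normK ?num_real// ler_sqr ?nnegrE ?mulr_ge0 ?(ltW dl0)//.
    have -> : (j i)%:R - n%:R * x ord0 i = - (n%:R * (x - grid j) ord0 i).
      by rewrite !mxE; field; rewrite gt_eqF.
    by rewrite normrN normrM (gtr0_norm nR0) [leLHS]mulrC ler_pM2l.
  have fB : `|f x - f (grid j)| <= 2 * B.
    rewrite (le_trans (ler_normB _ _))//.
    by have := BP _ cx; have := BP _ (cgrid j); lra.
  rewrite (bigD1 i)//= mulrDr.
  have : 2 * B <= c * ((j i)%:R - n%:R * x ord0 i) ^+ 2.
    by rewrite /c mulrAC ler_pdivlMr ?exprn_gt0 ?mulr_gt0// ler_pM2l// mulr_gt0.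
  have : 0 <= c * \sum_(i0 < d | i0 != i) ((j i0)%:R - n%:R * x ord0 i0) ^+ 2.
    by rewrite mulr_ge0// sumr_ge0// => *; exact: sqr_ge0.
  by move: fB; lra.
have variance i : \sum_j W x j * ((j i)%:R - n%:R * x ord0 i) ^+ 2 <= n%:R.
  have cxi := cx i.
  pose h i' k : R := if i' == i then (k%:R - n%:R * x ord0 i) ^+ 2 else 1.
  have -> : \sum_j W x j * ((j i)%:R - n%:R * x ord0 i) ^+ 2 =
      \sum_j W x j * \prod_i' h i' (j i').
    apply: eq_bigr => j _; rewrite (bigD1 i)//= /h eqxx big1 ?mulr1//.
    by move=> i' /negbTE ->.
  rewrite tensor_bernstein_mean (bigD1 i)//= big1 ?mulr1; last first.
    by move=> i' /negbTE i'i; rewrite /h i'i bernstein_mean1.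
  rewrite /h eqxx bernstein_variance ler_piMr//; nra.
have -> : f x - \sum_j f (grid j) * W x j =
    \sum_j W x j * (f x - f (grid j)).
  under [RHS]eq_bigr do rewrite mulrBr (mulrC _ (f (grid _))).
  by rewrite sumrB -big_distrl/= W1 mul1r.
apply: (le_trans (ler_norm_sum _ _ _)).
apply: (@le_trans _ _ (\sum_j (W x j * (e / 2) +
    \sum_i c * (W x j * ((j i)%:R - n%:R * x ord0 i) ^+ 2)))).
  apply: ler_sum => j _; rewrite normrM ger0_norm//.
  rewrite (le_trans (ler_wpM2l (W0 j) (dist j)))// mulrDr lerD2l.
  rewrite !big_distrr/=; apply: ler_sum => i _.
  by rewrite mulrCA.
rewrite big_split/= -big_distrl/= W1 mul1r exchange_big/=.
have : \sum_(i < d) \sum_j c * (W x j * ((j i)%:R - n%:R * x ord0 i) ^+ 2) <=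
    \sum_(i < d) c * n%:R.
  by apply: ler_sum => i _; rewrite -big_distrr/= ler_wpM2l.
rewrite sumr_const card_ord -[_ *+ d]mulr_natr.
have -> : c * n%:R * d%:R = 2 * B * d%:R / dl ^+ 2 / n%:R.
  by rewrite /c; field; rewrite !gt_eqF.
by move: nP; lra.
Qed.

End cube_functions.

(** * Approximation by the spans of a convergence sequence *)

Section smooth_functions.
Variables (R : realType) (d : nat).
Local Notation E := 'rV[R]_d.
Implicit Types (f g p : E -> R) (x y : E).

Lemma poly_in_Cr r p : poly_fun p -> in_Cr r p.
Proof.
move=> pp; split; first exact: poly_in_C.
- by move=> l i x _ _; apply: poly_derivable; exact: poly_partial.
- move=> l _; exists (partial l p) => //.
  by apply: poly_in_C; exact: poly_partial.
Qed.

(** The induction removes the derivative that is applied first, that is the last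
    entry of the list, as the polynomial then changes and the order drops. *)
Lemma poly_partial_bounded r p : poly_fun p ->
  exists2 B : R, 0 < B & forall (l : seq 'I_d), (size l <= r)%N ->
    forall x, cube x -> `|partial l p x| <= B.
Proof.
elim: r p => [|r IH] p pp.
  have [B B0 BP] := in_C_bounded (poly_in_C pp).
  by exists B => // l; rewrite leqn0 size_eq0 => /eqP -> x; exact: BP.
have [B B0 BP] := in_C_bounded (poly_in_C pp).
have H (i : 'I_d) : {C : R | 0 < C & forall (l : seq 'I_d), (size l <= r)%N ->
    forall x, cube x -> `|partial (rcons l i) p x| <= C}.
  apply: cid2; have [C C0 CP] := IH _ (poly_derive (delta_mx ord0 i) pp).
  by exists C => // l lr x cx; rewrite /partial foldr_rcons; exact: CP.
exists (B + \sum_i s2val (H i)).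
  by rewrite ltr_wpDr// sumr_ge0// => i _; case: (H i) => /= C /ltW.
move=> l; case: (lastP l) => [_|{}l i].
  move=> x cx; rewrite (le_trans (BP _ cx))// lerDl sumr_ge0// => i _.
  by case: (H i) => /= C /ltW.
rewrite size_rcons ltnS => lr x cx; rewrite (bigD1 i)//= addrCA.
have := s2valP' (H i) l lr x cx; move=> /le_trans; apply.
rewrite lerDl addr_ge0 ?(ltW B0)// sumr_ge0// => j _.
by case: (H j) => /= C /ltW.
Qed.

Lemma sup_cube_le f (e : R) :
  (sup_cube f <= e%:E)%E <-> forall x, cube x -> `|f x| <= e.
Proof.
split=> [fe x cx|fe]; last first.
  by apply: ge_ereal_sup => _ [x cx <-]; rewrite lee_fin fe.
by rewrite -lee_fin (le_trans _ fe)//; apply: ereal_sup_ubound; exists x.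
Qed.

(** The rate of convergence is uniform only over the unit ball of [C^r]. A
    polynomial divided by a bound on its derivatives lies in that ball, and
    polynomials are dense in [C(V)]. *)
Lemma span_dense (kappa : nat -> nat) (phi : forall n, 'I_(kappa n) -> E -> R)
    (r : nat) (s t : R) f (e : R) :
  convergence_sequence phi r s t -> 0 < t -> in_C f -> 0 < e ->
  exists N, forall n, (N <= n)%N -> (0 < n)%N ->
    exists2 v, phi_span phi n v & forall x, cube x -> `|f x - v x| <= e.
Proof.
move=> [_ _ [Pi [PiP [C [N CN]]]]] t0 fc e0.
have e20 : 0 < e / 2 by rewrite divr_gt0.
have [p pp fp] := poly_dense fc e20.
have [B B0 BP] := poly_partial_bounded r pp.
pose b : R := B^-1; have b0 : 0 < b by rewrite invr_gt0.
pose q x := b * p x.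
have pq : poly_fun q by apply: poly_mul => //; exact: poly_cst.
have q1 : (Cr_norm r q <= 1)%E.
  apply: ge_ereal_sup => _ [[l x] [/= lr ox] <-].
  rewrite lee_fin partialZ// normrM gtr0_norm// ler_pdivrMl// mulr1.
  by apply: BP => // i; have /andP[/ltW -> /ltW ->] := ox i.
pose e' : R := e / 2 / (B * (`|C| + 1)).
have C1 : 0 < `|C| + 1 by rewrite ltr_wpDl.
have e'0 : 0 < e' by rewrite divr_gt0 ?mulr_gt0.
(* The threshold from which on [1 / n ^ t <= e']. *)
pose a : R := e'^-1 `^ t^-1.
exists (maxn N (Num.truncn a).+1) => n; rewrite geq_max => /andP[Nn an] n0.
exists (fun x => B * Pi n q x).
  have [[c ->] _] := PiP n q n0 (poly_in_Cr r pq).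
  exists (fun m => B * c m); apply/funext => x; rewrite big_distrr/=.
  by apply: eq_bigr => m _; rewrite mulrA.
have nt : 1 / n%:R `^ t <= e'.
  have aN : a <= n%:R.
    by apply: (le_trans (ltW (truncnS_gt a))); rewrite ler_nat.
  have : a `^ t <= n%:R `^ t.
    apply: ge0_ler_powR; rewrite ?nnegrE ?ler0n ?(ltW t0)//.
    exact: powR_ge0.
  rewrite /a -powRrM mulVf ?gt_eqF// powRr1 ?invr_ge0 ?(ltW e'0)// => e'n.
  rewrite div1r -[leRHS]invrK lef_pV2 ?posrE ?invr_gt0//.
  by rewrite (lt_le_trans _ e'n)// invr_gt0.
move=> x cx.
have qx : `|q x - Pi n q x| <= C * (1 / n%:R `^ t).
  have : (sup_cube (q \- Pi n q)%R <= (C * (1 / n%:R `^ t))%:E)%E.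
    apply: le_trans (CN n n0 Nn); apply: ereal_sup_ubound.
    by exists q => //; split => //; exact: poly_in_Cr.
  by move=> /sup_cube_le/(_ x cx).
have nt0 : 0 <= 1 / n%:R `^ t by rewrite div1r invr_ge0 powR_ge0.
have Ce : C * (1 / n%:R `^ t) <= (`|C| + 1) * e'.
  apply: (@le_trans _ _ ((`|C| + 1) * (1 / n%:R `^ t))).
    by rewrite ler_wpM2r// (le_trans (ler_norm C))// lerDl.
  by rewrite ler_pM2l.
have px : `|p x - B * Pi n q x| <= e / 2.
  have -> : p x - B * Pi n q x = B * (q x - Pi n q x).
    by rewrite mulrBr /q /b mulrA mulfV ?mul1r// gt_eqF.
  rewrite normrM gtr0_norm//.
  have -> : e / 2 = B * ((`|C| + 1) * e').
    by rewrite /e'; field; rewrite !gt_eqF.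
  by rewrite ler_pM2l// (le_trans qx).
by have := ler_distD (p x) (f x) (B * Pi n q x); have := fp x cx; lra.
Qed.

End smooth_functions.

(** * Borel sets are measurable for Hausdorff measure *)

Section hausdorff_borel.
Variables (R : realType) (d k : nat).
Local Notation E := 'rV[R]_d.
Implicit Types (A B P Q : set E).

Lemma norm_le_euclid (x : E) : `|x| <= euclid x.
Proof.
rewrite row_norm_le ?sqrtr_ge0//; apply/forallP => i.
rewrite -sqrtr_sqr /euclid ler_wsqrtr// (bigD1 i)//= lerDl.
by apply: sumr_ge0 => j _; exact: sqr_ge0.
Qed.

Local Open Scope ereal_scope.

Lemma norm_le_diameter B (x y : E) : B x -> B y -> `|x - y|%:E <= diameter B.
Proof.
move=> Bx By; apply: (@le_trans _ _ (euclid (x - y))%:E).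
  by rewrite lee_fin norm_le_euclid.
by apply: ereal_sup_ubound; exists (x, y).
Qed.

Lemma hausdorff_gauge_anti (delta delta' : R) B : (delta <= delta')%R ->
  hausdorff_gauge k delta' B <= hausdorff_gauge k delta B.
Proof.
move=> dd; rewrite /hausdorff_gauge; case: pselect => // Bn0.
have [dB|_] := boolP (diameter B <= delta%:E); last by rewrite leey.
by rewrite (le_trans dB)// lee_fin.
Qed.

Lemma mu_ext_gauge_anti (delta delta' : R) A : (delta <= delta')%R ->
  mu_ext (hausdorff_gauge k delta') A <= mu_ext (hausdorff_gauge k delta) A.
Proof.
move=> dd; apply: le_ereal_inf_tmp => _ [F cF <-].
apply: (@le_trans _ _ (\sum_(i <oo) hausdorff_gauge k delta' (F i))).
  by apply: ereal_inf_lbound; exists F.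
apply: lee_nneseries => i _; first by move=> _; exact: hausdorff_gauge_ge0.
exact: hausdorff_gauge_anti.
Qed.

(** A set of diameter less than the distance between [P] and [Q] meets at most
    one of them, so that a fine covering of the union splits into a covering of
    [P] and a covering of [Q]. *)
Lemma mu_ext_gauge_separated (delta eta : R) P Q : (delta < eta)%R ->
  (forall x y, P x -> Q y -> (eta <= `|x - y|)%R) ->
  mu_ext (hausdorff_gauge k delta) P + mu_ext (hausdorff_gauge k delta) Q
    <= mu_ext (hausdorff_gauge k delta) (P `|` Q).
Proof.
move=> de PQ; apply: le_ereal_inf_tmp => _ [F [mF FPQ] <-].
pose meeting S i : set E := if pselect (F i `&` S !=set0) then F i else set0.
have mu_ext_meeting S : S `<=` \bigcup_i F i ->
    mu_ext (hausdorff_gauge k delta) S <=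
    \sum_(i <oo) hausdorff_gauge k delta (meeting S i).
  move=> SF; apply: ereal_inf_lbound; exists (meeting S) => //; split=> // x Sx.
  have [i _ Fix] := SF x Sx; exists i => //; rewrite /meeting.
  by case: pselect => // -[]; exists x.
have SP := mu_ext_meeting P (subset_trans (@subsetUl _ P Q) FPQ).
have SQ := mu_ext_meeting Q (subset_trans (@subsetUr _ P Q) FPQ).
rewrite (le_trans (leeD SP SQ))// -nneseriesD; last 2 first.
- by move=> i _ _; exact: hausdorff_gauge_ge0.
- by move=> i _ _; exact: hausdorff_gauge_ge0.
apply: lee_nneseries => i _.
  by move=> _; apply: adde_ge0; exact: hausdorff_gauge_ge0.
rewrite /meeting; case: pselect => [[x [Fx Px]]|nP]; case: pselect => [[y [Fy Qy]]|nQ].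
- rewrite [leRHS]/hausdorff_gauge; case: pselect => [F0|Fn0].
    by have : set0 x by rewrite -F0.
  rewrite ifF ?leey//=; apply/negbTE; rewrite -ltNge.
  apply: lt_le_trans (norm_le_diameter Fx Fy).
  by rewrite lte_fin (lt_le_trans de)// PQ.
- by rewrite hausdorff_gauge0 adde0.
- by rewrite hausdorff_gauge0 add0e.
- by rewrite hausdorff_gauge0 adde0 hausdorff_gauge_ge0.
Qed.

(** At every scale below [eta] the coverings split; the inequality passes to the
    supremum over the scales. *)
Lemma hausdorff_separated (eta : R) P Q : (0 < eta)%R ->
  (forall x y, P x -> Q y -> (eta <= `|x - y|)%R) ->
  hausdorff k P + hausdorff k Q <= hausdorff k (P `|` Q).
Proof.
move=> eta0 PQ.
have [->|HPQ] := eqVneq (hausdorff k (P `|` Q)) +oo; first by rewrite leey.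
have fin S : S `<=` P `|` Q -> hausdorff k S \is a fin_num.
  move=> SPQ; rewrite ge0_fin_numE ?hausdorff_ge0//.
  by rewrite (le_lt_trans (le_hausdorff k SPQ))// ltey.
rewrite -leeBrDr ?fin//.
apply: ge_ereal_sup => _ [d1 /= d10 <-].
rewrite leeBrDr ?fin// addeC -leeBrDr; last first.
  rewrite ge0_fin_numE; last by apply: mu_ext_ge0; exact: hausdorff_gauge_ge0.
  apply: (@le_lt_trans _ _ (hausdorff k P)).
    by apply: ereal_sup_ubound; exists d1.
  by rewrite -ge0_fin_numE ?fin ?hausdorff_ge0//; exact: subsetUl.
apply: ge_ereal_sup => _ [d2 /= d20 <-].
rewrite leeBrDr; last first.
  rewrite ge0_fin_numE; last by apply: mu_ext_ge0; exact: hausdorff_gauge_ge0.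
  apply: (@le_lt_trans _ _ (hausdorff k P)).
    by apply: ereal_sup_ubound; exists d1.
  by rewrite -ge0_fin_numE ?fin ?hausdorff_ge0//; exact: subsetUl.
pose dl : R := (Num.min (Num.min d1 d2) (eta / 2))%R.
have dl0 : (0 < dl)%R by rewrite !lt_min d10 d20 divr_gt0.
have dle : (dl < eta)%R by rewrite !gt_min [X in _ || X]ltr_pdivrMr// ltr_pMr// ltr1n orbT.
apply: (@le_trans _ _ (mu_ext (hausdorff_gauge k dl) (P `|` Q))); last first.
  by apply: ereal_sup_ubound; exists dl.
rewrite addeC; apply: le_trans (mu_ext_gauge_separated dle PQ).
by apply: leeD; apply: mu_ext_gauge_anti; rewrite !ge_min lexx ?orbT.
Qed.



(** Caratheodory's criterion for metric outer measures. The part of [X] at distance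
    at least [1 / (n + 1)] from [A] is separated from [A], so that only the
    measure of the remaining part of [X `\` A] has to tend to [0]. That part is
    cut into the layers between the distances [1 / (i + 2)] and [1 / (i + 1)],
    for [n <= i]. Layers whose indices differ by at least 2 are separated, so
    that the measures of the layers of even index, and those of odd index, sum up
    to at most the measure of [X]: the series of all layers converges and its
    tails vanish. *)
Lemma closed_caratheodory A : closed A -> (hausdorff k).-caratheodory A.
Proof.
move=> cA; apply: le_caratheodory_measurable => X.
change (hausdorff k (X `&` A) + hausdorff k (X `&` ~` A) <= hausdorff k X).
have [->|HX] := eqVneq (hausdorff k X) +oo; first by rewrite leey.
have HXfin : hausdorff k X \is a fin_num.
  by rewrite ge0_fin_numE ?hausdorff_ge0// ltey.
pose far (r : R) : set E := [set x | forall a, A a -> (r <= `|x - a|)%R].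
pose close (r : R) : set E := [set x | exists2 a, A a & (`|x - a| < r)%R].
have far_anti r r' : (r <= r')%R -> far r' `<=` far r.
  by move=> rr x xf a Aa; rewrite (le_trans rr)// xf.
have sep (r r' : R) P Q : (r' < r)%R -> P `<=` far r -> Q `<=` close r' ->
    hausdorff k P + hausdorff k Q <= hausdorff k (P `|` Q).
  move=> rr Pr Qr; apply: (@hausdorff_separated (r - r')).
    by rewrite subr_gt0.
  move=> x y /Pr xr /Qr [a Aa ya].
  by have := xr a Aa; have := ler_distD y x a; lra.
pose rad n : R := (n.+1%:R^-1)%R.
have rad0 n : (0 < rad n)%R by rewrite /rad invr_gt0.
pose C n := X `&` far (rad n).
pose D n := X `&` (far (rad n.+1) `&` close (rad n)).
have XAC n : hausdorff k (X `&` A) + hausdorff k (C n) <= hausdorff k X.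
  rewrite addeC; apply: le_trans (le_hausdorff k (_ : C n `|` (X `&` A) `<=` X)).
    apply: (sep (rad n) (rad n / 2)%R) => [|x []//|x [_ Ax]].
      by rewrite ltr_pdivrMr// ltr_pMr// ltr1n.
    by exists x => //; rewrite subrr normr0 divr_gt0.
  by move=> x [[]|[]].
have layers n m : C (n + m)%N `<=` C n `|` \bigcup_(i in ~` `I_n) D i.
  elim: m => [|m IH]; first by rewrite addn0; exact: subsetUl.
  move=> x [Xx fx]; have [cx|] := pselect (C (n + m)%N x); first exact: IH.
  move=> nCx; right; exists (n + m)%N.
    by rewrite /= /`I_n/= ltnNge leq_addr.
  split=> //; split; first by rewrite -addnS.
  apply: contrapT => ncx; apply: nCx; split => // a Aa.
  by rewrite leNgt; apply/negP => xa; apply: ncx; exists a.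
have XnA n : X `&` ~` A `<=` C n `|` \bigcup_(i in ~` `I_n) D i.
  move=> x [Xx nAx].
  have /nbhs_ballP[r /= r0 rA] : nbhs x (~` A).
    by apply: open_nbhs_nbhs; split => //; exact: closed_openC.
  have xr : far r x.
    move=> a Aa; rewrite leNgt; apply/negP => xa.
    by apply: (rA a) => //; rewrite -ball_normE.
  pose m := Num.truncn r^-1.
  apply: (layers n m); split => //; apply: far_anti xr.
  rewrite /rad -[leRHS]invrK lef_pV2 ?posrE ?ltr0n ?invr_gt0//.
  by rewrite (le_trans (ltW (truncnS_gt r^-1)))// ler_nat ltnS leq_addl.
have parity b N : \sum_(i < N) hausdorff k (D (i.*2 + b)%N) <= hausdorff k X.
  apply: (@le_trans _ _ (hausdorff k (\big[setU/set0]_(i < N) D (i.*2 + b)%N))).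
    elim: N => [|N IH]; first by rewrite !big_ord0 hausdorff0.
    rewrite !big_ord_recr/=; apply: le_trans (leeD2r _ IH) _.
    pose j : R := (N.*2 + b)%:R.
    have j0 : (0 <= j)%R by exact: ler0n.
    (* The layers of index at most [j - 2] stay at distance [1 / j] from [A]; the
       shift by [1 / 2] avoids an inverse of [0] for [j = 0]. *)
    apply: (sep (j + 2^-1)^-1%R (j + 1)^-1%R).
    - by rewrite ltf_pV2 ?posrE; lra.
    - rewrite -(bigcup_mkord N (fun i => D (i.*2 + b)%N)) => x [i /= iN [_ [+ _]]]; apply: far_anti.
      rewrite /rad lef_pV2 ?posrE ?ltr0n//; last by lra.
      apply: (@le_trans _ _ j); last by lra.
      by rewrite ler_nat -addn2 addnAC leq_add2r addn2 -doubleS leq_double.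
    - by move=> x [_ [_]]; rewrite /rad -natr1.
  by apply: le_hausdorff; rewrite -(bigcup_mkord N (fun i => D (i.*2 + b)%N)) => x [i _ []].
have summable : \sum_(i <oo) hausdorff k (D i) < +oo.
  apply: (@le_lt_trans _ _ (hausdorff k X + hausdorff k X)); last first.
    by rewrite -ge0_fin_numE ?adde_ge0 ?hausdorff_ge0// fin_numD HXfin.
  apply: lime_le; first by apply: is_cvg_nneseries => *; exact: hausdorff_ge0.
  near=> n; rewrite big_mkord.
  apply: (@le_trans _ _ (\sum_(i < n.*2) hausdorff k (D i))).
    rewrite -!(big_mkord xpredT (fun i => hausdorff k (D i))).
    apply: lee_sum_nneg_natr => // [i _ _|]; first exact: hausdorff_ge0.
    by rewrite -addnn leq_addr.
  apply: le_trans (leeD (parity 0%N n) (parity 1%N n)); rewrite -big_split/=.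
  elim: (n) => [|m IH]; first by rewrite !big_ord0.
  rewrite doubleS !big_ord_recr/= -addeA; apply: leeD => //.
  by rewrite addn0 addn1.
apply/lee_addgt0Pr => e e0.
have [n nP] : exists n, \sum_(n <= i <oo) hausdorff k (D i) <= e%:E.
  have /fine_cvgP[[N _ fN] /cvgrPdist_le/(_ e e0) [M _ MP]] :=
    nneseries_tail_cvg summable (fun i _ => hausdorff_ge0 k (D i)).
  exists (maxn N M); rewrite -(fineK (fN _ (leq_maxl N M))) lee_fin.
  apply: le_trans (MP _ (leq_maxr N M)) => /=.
  by rewrite sub0r normrN ler_norm.
apply: le_trans (leeD (XAC n) nP); rewrite -addeA leeD2l//.
apply: le_trans (le_hausdorff k (XnA n)) _.
apply: le_trans (outer_measureU2 (hausdorff k) _ _) _; apply: leeD2l.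
exact: (outer_measure_sigma_subadditive_tail (hausdorff k)).
Unshelve. all: by end_near. Qed.

End hausdorff_borel.

(** * Manifold functions as functionals on continuous functions *)

Section functionals.
Variables (R : realType) (d k : nat).
Local Notation E := 'rV[R]_d.
Local Notation X := (manifold_function R d k).
Local Notation T := (caratheodory_type (@hausdorff R d k)).
Local Notation mu := (@hausdorff_measure R d k).
Implicit Types (f g : E -> R) (x y : X) (F : (E -> R) -> R).

(** Membership in the dual of [C(V)]. Additivity and homogeneity are restricted to
    continuous functions, as the integral of a function that is not measurable
    is a junk value. *)
Definition C_dual F : Prop :=
  [/\ forall f g, in_C f -> in_C g -> F (fun z => f z + g z) = F f + F g,
      forall c f, in_C f -> F (fun z => c * f z) = c * F f
    & exists2 N : R, 0 <= N & forall f B, in_C f ->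
        (forall z, cube z -> `|f z| <= B) -> `|F f| <= N * B].

Lemma C_dual_sum F (I : Type) (s : seq I) (c : I -> R) (f : I -> E -> R) :
  C_dual F -> (forall i, in_C (f i)) ->
  F (fun z => \sum_(i <- s) c i * f i z) = \sum_(i <- s) c i * F (f i).
Proof.
move=> [FD FZ _] cf; elim: s => [|i s IH].
  rewrite big_nil; have c0 : in_C (fun _ : E => 0 : R).
    by apply: poly_in_C; exact: poly_cst.
  under eq_fun do rewrite big_nil -(mul0r 0).
  by rewrite FZ// mul0r.
rewrite big_cons; under eq_fun do rewrite big_cons.
rewrite FD ?FZ ?IH//; first exact: in_CZ.
by apply: in_C_sum => j; exact: in_CZ.
Qed.

Lemma C_dualB_arg F f g : C_dual F -> in_C f -> in_C g ->
  F (f \- g) = F f - F g :> R.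
Proof.
move=> [FD FZ _] cf cg; rewrite -(mulN1r (F g)) -FZ// -FD//; last exact: in_CZ.
by congr F; apply/funext => z /=; rewrite mulN1r.
Qed.

Lemma C_dualB F G : C_dual F -> C_dual G -> C_dual (fun f => F f - G f).
Proof.
move=> [FD FZ [N N0 FN]] [GD GZ [M M0 GM]]; split.
- by move=> f g cf cg; rewrite FD// GD//; ring.
- by move=> c f cf; rewrite FZ// GZ//; ring.
- exists (N + M) => [|f B cf fB]; first exact: addr_ge0.
  by rewrite (le_trans (ler_normB _ _))// mulrDl lerD// ?FN ?GM.
Qed.

Lemma C_dual_dual_norm F (e B : R) f : C_dual F -> (dual_norm F <= e%:E)%E ->
  0 < B -> in_C f -> (forall z, cube z -> `|f z| <= B) -> `|F f| <= e * B.
Proof.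
move=> [_ FZ _] Fe B0 cf fB.
rewrite mulrC -ler_pdivrMl//.
rewrite -[X in X * _](gtr0_norm (_ : 0 < B^-1)) ?invr_gt0// -normrM -FZ//.
rewrite -lee_fin (le_trans _ Fe)//; apply: ereal_sup_ubound.
exists (fun z => B^-1 * f z) => //; split; first exact: in_CZ.
apply/sup_cube_le => z cz; rewrite normrM gtr0_norm ?invr_gt0//.
by rewrite ler_pdivrMl// mulr1 fB.
Qed.

Lemma carrier_cube x : carrier x `<=` cube.
Proof.
case: (carrierP x) => m [A [_ AP _ ->]] z [i _ Az].
by have [_ + _ _] := AP i; apply.
Qed.

Lemma carrier_measurable x : measurable (carrier x : set T).
Proof.
case: (carrierP x) => m [A [_ AP _ ->]].
apply: (@fin_bigcup_measurable _ T) => [|i _]; first exact: finite_finset.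
apply: closed_caratheodory; apply: compact_closed.
  exact: norm_hausdorff.
by have [] := AP i.
Qed.

Lemma carrier_finite x : (mu (carrier x) < +oo)%E.
Proof.
case: (carrierP x) => m [A [_ AP _ ->]].
apply: (@le_lt_trans _ _ (hausdorff k (\big[setU/set0]_i A i))).
  by apply: le_hausdorff => z [i _ Aiz]; rewrite (bigD1 i)//=; left.
elim/big_ind: _ => [|S U SF UF|i _]; first by rewrite hausdorff0.
- apply: le_lt_trans (outer_measureU2 (hausdorff k) _ _) _.
  exact: lte_add_pinfty.
- by have [] := AP i.
Qed.

(** Inside the cube the preimage of an open ray is the trace of an open set, which
    is measurable by [closed_caratheodory]. *)
Lemma in_C_measurable (M : set T) f : measurable M -> M `<=` cube -> in_C f ->
  measurable_fun M (f : T -> R).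
Proof.
move=> mM Mc cf _; apply: (measurability _ (RGenOInfty.measurableE R)) => //.
move=> _ [_ [a ->] <-].
have oa : open (`]a, +oo[%classic : set R) by exact: interval_open.
have /continuousP/(_ _ oa)/open_subspaceP[V oV VE] := cf.
have -> : M `&` f @^-1` `]a, +oo[ = M `&` V.
  by rewrite -(setIidl Mc) -!setIA ![cube `&` _]setIC VE.
apply: measurableI => //; rewrite -[V]setCK; apply: measurableC.
by apply: closed_caratheodory; exact: open_closedC.
Qed.

Lemma integral_C_dual (M : set T) (w : T -> R) : measurable M -> M `<=` cube ->
  mu.-integrable M (EFin \o w) ->
  C_dual (fun f => \int[mu]_(z in M) (w z * f z)).
Proof.
move=> mM Mc iw.
have iwf f : in_C f -> mu.-integrable M (EFin \o (fun z => w z * f z)).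
  move=> cf; have [B B0 fB] := in_C_bounded cf.
  apply: (integrableMl mM iw); first exact: in_C_measurable.
  exists B; split; first exact: num_real.
  move=> y By z Mz; apply: le_trans (ltW By).
  exact/fB/Mc.
split.
- move=> f g cf cg; rewrite -RintegralD ?iwf//.
  by apply: eq_Rintegral => z _; rewrite mulrDr.
- move=> c f cf; rewrite -RintegralZl ?iwf//.
  by apply: eq_Rintegral => z _; rewrite mulrCA.
- exists (\int[mu]_(z in M) `|w z|); first by apply: Rintegral_ge0.
  move=> f B cf fB; apply: (le_trans (le_normr_Rintegral mM (iwf f cf))).
  have iaw : mu.-integrable M (EFin \o (fun z => `|w z|)) by exact: integrable_norm.
  rewrite -RintegralZr//; apply: le_Rintegral => //.
  + exact: (integrable_norm (iwf f cf)).
  + by have := integrableZr mM B iaw; apply: eq_integrable => // z _.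
  + by move=> z Mz; rewrite normrM ler_wpM2l//; exact/fB/Mc.
Qed.

Lemma carrier_C_dual x : C_dual (carrier_dual x).
Proof.
have -> : carrier_dual x = fun f => \int[mu]_(z in carrier x) (cst 1 z * f z).
  by apply/funext => f; apply: eq_Rintegral => z _; rewrite mul1r.
apply: integral_C_dual; [exact: carrier_measurable|exact: carrier_cube|].
apply: measurable_bounded_integrable.
- exact: carrier_measurable.
- exact: carrier_finite.
- exact: measurable_cst.
- exact: bounded_cst.
Qed.

(** On a set of finite measure [L^2] is contained in [L^1], since
    [|w| <= 1 + w ^ 2]. *)
Lemma density_integrable x :
  mu.-integrable (carrier x) (EFin \o (density x : T -> R)).
Proof.
have mM := carrier_measurable x.
have sq := Lfun2_integrable_sqr (densityP x).
have sqM : mu.-integrable (carrier x) (EFin \o (fun z => density x z ^+ 2)).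
  have := integrableS measurableT mM (@subsetT _ _) sq.
  apply: eq_integrable => // z zM; rewrite /= patchE zM//.
have one : mu.-integrable (carrier x) (EFin \o cst 1).
  apply: measurable_bounded_integrable => //; first exact: carrier_finite.
  exact: bounded_cst.
apply: (le_integrable mM _ _ (integrableD mM one sqM)).
  apply/measurable_EFinP/(measurable_restrictT _ mM).2.
  by have := densityP x; rewrite inE => /andP[]; rewrite inE.
move=> z _; rewrite /= lee_fin.
have : 0 <= density x z ^+ 2 by exact: sqr_ge0.
rewrite -[X in 0 <= X]real_normK ?num_real// => s0.
rewrite [leRHS]ger0_norm ?addr_ge0 ?sqr_ge0//.
by rewrite -[X in _ + X]real_normK ?num_real//; have := normr_ge0 (density x z); nra.
Qed.

Lemma density_C_dual x : C_dual (density_dual x).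
Proof.
apply: integral_C_dual; [exact: carrier_measurable|exact: carrier_cube|].
exact: density_integrable.
Qed.

End functionals.

(** * Separation by the encoders *)

Section moments.
Variables (R : realType) (d k : nat).
Local Notation E := 'rV[R]_d.
Local Notation X := (manifold_function R d k).
Implicit Types (f g : E -> R) (x y : X).

(** The two components of an element of [X_k] are functionals of the same kind, so
    that the argument is run once, for both values of [b]. *)
Definition moment (b : bool) x f : R :=
  if b then carrier_dual x f else density_dual x f.

Lemma moment_C_dual b x : C_dual (moment b x).
Proof. by case: b; [exact: carrier_C_dual|exact: density_C_dual]. Qed.

Lemma moment_ball b x y f (e B : R) : mf_ball x e y -> 0 < B -> in_C f ->
  (forall z, cube z -> `|f z| <= B) -> `|moment b x f - moment b y f| <= e * B.
Proof.
move=> xy B0 cf fB.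
have D := C_dualB (moment_C_dual b x) (moment_C_dual b y).
apply: (C_dual_dual_norm D) => //; apply: le_trans (ltW xy).
by case: b {D}; rewrite /mf_dist ?leeDl ?leeDr ?dual_norm_ge0.
Qed.

Lemma moment_neq x y e : 0 < e -> ~ mf_ball x e y ->
  exists b f, [/\ in_C f, forall z, cube z -> `|f z| <= 1
                & moment b x f != moment b y f].
Proof.
move=> e0 xy; apply: contrapT => H; apply: xy.
have H' b : (dual_norm (fun f => moment b x f - moment b y f)%R <= 0)%E.
  apply: ge_ereal_sup => _ [f [cf /sup_cube_le f1] <-].
  rewrite lee_fin normr_le0 subr_eq0; apply/negP => /negP fxy.
  by apply: H; exists b, f.
apply: (@le_lt_trans _ _ (0 + 0)%E); last by rewrite adde0 lte_fin.
exact: leeD (H' true) (H' false).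
Qed.

Lemma moment_continuous b f : in_C f -> continuous (fun x => moment b x f).
Proof.
move=> cf x; have [B B0 fB] := in_C_bounded cf.
have nbF : Filter (nbhs x) by exact: nbhs_filter.
apply/(@cvgrPdist_le _ _ _ _ nbF) => e e0; apply/nbhs_ballP; exists (e / B) => /=.
  by rewrite divr_gt0.
move=> y xy; rewrite -[leRHS](divfK (lt0r_neq0 B0)).
exact: moment_ball xy B0 cf fB.
Qed.

Variables (kappa : nat -> nat) (phi : forall n, 'I_(kappa n) -> E -> R).

Lemma encoder_moment n x y : encoder phi n x = encoder phi n y ->
  forall b (m : 'I_(kappa n)), moment b x (phi m) = moment b y (phi m).
Proof.
move=> /eq_row_mx[/rowP c1 /rowP c2] b m.
by have := c1 m; have := c2 m; rewrite !mxE; case: b.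
Qed.

Lemma encoder_continuous n : (forall m : 'I_(kappa n), in_C (phi m)) ->
  continuous (encoder phi n : X -> _).
Proof.
move=> cphi; apply: row_continuous => j.
rewrite -[j]fintype.splitK; case: (fintype.split j) => m /=.
  by under eq_fun do rewrite row_mxEl mxE; exact: (@moment_continuous true).
by under eq_fun do rewrite row_mxEr mxE; exact: (@moment_continuous false).
Qed.

(** If the distance of [x] and [y] is positive, some continuous [f] distinguishes
    them, and so does every function [w] close to [f], uniformly near [x] and [y].
    For [n] large such a [w] exists in the [n]-th span, on which the functionals
    are determined by the encoder. *)
Lemma encoder_separates (r : nat) (s t : R) x y e :
  convergence_sequence phi r s t -> 0 < t -> 0 < e -> ~ mf_ball x e y ->
  exists2 rho : R, 0 < rho & exists N, forall n, (N <= n)%N -> (0 < n)%N ->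
    forall x' y', mf_ball x rho x' -> mf_ball y rho y' ->
      encoder phi n x' <> encoder phi n y'.
Proof.
move=> conv t0 e0 xy.
have [b [f [cf f1 fxy]]] := moment_neq e0 xy.
pose eta := `|moment b x f - moment b y f|.
have eta0 : 0 < eta by rewrite normr_gt0 subr_eq0.
have [_ _ [Nx Nx0 xN]] := moment_C_dual b x.
have [_ _ [Ny Ny0 yN]] := moment_C_dual b y.
(* Moving from [x] to [x'], from [y] to [y'], and replacing [f] by [w] on both
   sides each change the difference by at most [eta / 4]. *)
pose e1 := eta / 4 / (Nx + Ny + 2).
have e10 : 0 < e1 by rewrite !divr_gt0//; lra.
have e1E : (Nx + Ny + 2) * e1 = eta / 4.
  by rewrite mulrC /e1 divfK//; apply/lt0r_neq0; lra.
have [N NP] := span_dense conv t0 cf e10.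
pose rho := Num.min 1 (eta / 4).
have rho0 : 0 < rho by rewrite lt_min ltr01 divr_gt0.
have rho1 : rho <= 1 by rewrite ge_min lexx.
have rhoe : rho <= eta / 4 by rewrite ge_min lexx orbT.
exists rho => //; exists N => n Nn n0 x' y' xx' yy' Exy.
have [w [c wc] fv] := NP n Nn n0.
have cphi (m : 'I_(kappa n)) : in_C (phi m) by case: conv => /(_ n m n0) [].
have cw : in_C w by rewrite wc; apply: in_C_sum => m; exact: in_CZ.
have wE : moment b x' w = moment b y' w.
  rewrite wc !(C_dual_sum _ _ (moment_C_dual _ _) cphi).
  by apply: eq_bigr => m _; rewrite (encoder_moment Exy).
have cfw : in_C (f \- w) by exact: in_CB.
have near_bound z z' M : mf_ball z rho z' ->
    `|moment b z (f \- w)| <= M * e1 ->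
    `|moment b z' f - moment b z' w| <= (M + 1) * e1.
  move=> zz' zM; rewrite -C_dualB_arg//; last exact: moment_C_dual.
  have := moment_ball b zz' e10 cfw fv.
  have := ler_wpM2r (ltW e10) rho1.
  have := ler_distD (moment b z (f \- w)) (moment b z' (f \- w)) 0.
  by rewrite !subr0 distrC mulrDl; lra.
have Hx := near_bound _ _ _ xx' (xN _ _ cfw fv).
have Hy := near_bound _ _ _ yy' (yN _ _ cfw fv).
have fx := moment_ball b xx' ltr01 cf f1.
have fy := moment_ball b yy' ltr01 cf f1.
rewrite wE in Hx.
have : eta <= 3 * (eta / 4).
  rewrite {1}/eta.
  have H1 := ler_distD (moment b x' f) (moment b x f) (moment b y f).
  have H2 := ler_distD (moment b y' f) (moment b x' f) (moment b y f).
  have H3 := ler_distD (moment b y' w) (moment b x' f) (moment b y' f).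
  rewrite (distrC (moment b y' f) (moment b y f)) in H2.
  rewrite (distrC (moment b y' w) (moment b y' f)) in H3.
  have : (Nx + 1) * e1 + (Ny + 1) * e1 = eta / 4 by rewrite -e1E; ring.
  by lra.
by lra.
Qed.

End moments.

(** * Factorization through a finite-dimensional map *)

Section factorization.
Variables (R : realType) (T : topologicalType) (Y : normedModType R) (N : nat).
Local Notation V := 'rV[R]_N.
Variables (K : set T) (G : T -> Y) (Phi : T -> V) (eps : R).
Hypotheses (cK : compact K) (cG : {within K, continuous G}).
Hypothesis cPhi : continuous Phi.

Lemma within_near x (e : R) : K x -> 0 < e ->
  \forall x' \near x, K x' -> `|G x - G x'| < e.
Proof.
move=> Kx e0; have /subspace_continuousP/(_ x Kx) := cG.
by move=> /cvgrPdist_lt/(_ e e0); rewrite near_withinE.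
Qed.

(** On the pairs where [G] differs by at least [eps], which form a compact set, the
    distance of the images under [Phi] is positive, hence bounded below. *)
Lemma separated_modulus :
  (forall x y, K x -> K y -> Phi x = Phi y -> `|G x - G y| < eps) ->
  exists2 delta : R, 0 < delta & forall x y, K x -> K y ->
    `|Phi x - Phi y| < delta -> `|G x - G y| < eps.
Proof.
move=> PhiG.
have Phi_near x (e : R) : 0 < e -> \forall x' \near x, `|Phi x - Phi x'| < e.
  by move=> e0; exact: (cvgrPdist_lt _ _).1 (cPhi (x:=x)) e e0.
have : \forall delta \near 0^'+, K `*` K `<=` [set p |
    `|Phi p.1 - Phi p.2| < delta -> `|G p.1 - G p.2| < eps].
  have /compact_near_coveringP/near_covering_withinP := compact_setX cK cK.
  apply => -[x y] [/= Kx Ky].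
  have [Pxy|Pxy] := eqVneq (Phi x) (Phi y).
    pose e : R := (eps - `|G x - G y|) / 2.
    have e0 : 0 < e by rewrite divr_gt0// subr_gt0 PhiG.
    pose near_G z := [set z' | K z' -> `|G z - G z'| < e].
    exists (near_G x `*` near_G y, setT).
      split; last exact: filterT.
      by exists (near_G x, near_G y) => //; split; exact: within_near.
    move=> [[x' y'] dl] [[/= Gx Gy] _] [/= Kx' Ky'] _.
    have := ler_distD (G x) (G x') (G y'); rewrite (distrC (G x') (G x)).
    have := ler_distD (G y) (G x) (G y').
    by move: (Gx Kx') (Gy Ky'); rewrite /e; lra.
  pose eta := `|Phi x - Phi y|.
  have eta0 : 0 < eta by rewrite normr_gt0 subr_eq0.
  pose near_Phi z := [set z' | `|Phi z - Phi z'| < eta / 4].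
  have e40 : 0 < eta / 4 by rewrite divr_gt0.
  exists (near_Phi x `*` near_Phi y, [set dl | dl < eta / 2]).
    split; last by apply: nbhs_right_lt; rewrite divr_gt0.
    by exists (near_Phi x, near_Phi y) => //; split; exact: Phi_near.
  move=> [[x' y'] dl] [[/= xx' yy'] dle] _ /= xy'.
  have := ler_distD (Phi x') (Phi x) (Phi y).
  have := ler_distD (Phi y') (Phi x') (Phi y); rewrite (distrC (Phi y') (Phi y)).
  by move: xx' yy' dle; rewrite /near_Phi /= -/eta; lra.
move=> [r /= r0 rP]; exists (r / 2); first by rewrite divr_gt0.
move=> x y Kx Ky xy; apply: (rP (r / 2) _ _ (x, y)) => //.
  by rewrite /= sub0r normrN gtr0_norm ?divr_gt0// ltr_pdivrMr// ltr_pMr// ltr1n.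
by rewrite divr_gt0.
Qed.

(** A partition of unity, subordinate to the balls of radius [delta] centred at a
    finite [delta / 2]-net of [Phi @` K], averages values of [G]. *)
Lemma finite_factorization (delta : R) : 0 < delta ->
  (forall x y, K x -> K y -> `|Phi x - Phi y| < delta -> `|G x - G y| < eps) ->
  exists2 p : nat, (0 < p)%N & exists (Gt : V -> 'rV[R]_p) (u : 'rV[R]_p -> Y),
    [/\ continuous Gt, continuous u
      & forall x, K x -> `|G x - u (Gt (Phi x))| <= eps].
Proof.
move=> delta0 PhiG.
have [[x0 Kx0]|K0] := pselect (K !=set0); last first.
  exists 1%N => //; exists (fun=> 0), (fun=> 0); split.
  - by move=> w; exact: cst_continuous.
  - by move=> w; exact: cst_continuous.
  - by move=> x Kx; case: K0; exists x.
have h0 : 0 < delta / 2 by rewrite divr_gt0.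
have cPhiK : compact (Phi @` K).
  by apply: continuous_compact => //; exact: continuous_subspaceT.
have [s sK sP] : exists2 s : seq T, {in s, forall x, K x} &
    forall x, K x -> exists2 y, y \in s & `|Phi x - Phi y| < delta / 2.
  move: cPhiK; rewrite compact_cover.
  move=> /(_ T K (fun x => ball (Phi x) (delta / 2)))[|_ [x Kx <-]|D DK KD].
  - by move=> x _; exact: ball_open.
  - by exists x => //; exact: ballxx.
  exists (finmap.enum_fset D) => [x /DK|x Kx]; first by rewrite inE.
  have [|y Dy xy] := KD (Phi x); first by exists x.
  by exists y => //; rewrite distrC; move: xy; rewrite -ball_normE.
have s0 : (0 < size s)%N by have [y] := sP _ Kx0; case: (s).
pose z (j : 'I_(size s)) : T := tnth (in_tuple s) j.
have zK j : K (z j) by apply: sK; exact: mem_tnth.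
pose b (j : 'I_(size s)) (w : V) : R := Num.max 0 (delta - `|w - Phi (z j)|).
have b0 j w : 0 <= b j w by rewrite le_max lexx.
(* On [Phi @` K] the sum is at least [delta / 2]; the maximum keeps the quotient
   continuous on the whole space. *)
pose S (w : V) : R := Num.max (delta / 2) (\sum_j b j w).
have S0 w : 0 < S w by rewrite lt_max h0.
have cmax (f g : V -> R) : continuous f -> continuous g ->
    continuous (fun w => Num.max (f w) (g w)).
  by move=> cf cg w; apply: continuous_max; [exact: cf|exact: cg].
have cb j : continuous (b j).
  apply: cmax => w; first exact: cst_continuous.
  apply: (@continuousB R R V (fun=> delta) (fun w => `|w - Phi (z j)|)).
    exact: cst_continuous.
  apply: (@continuous_comp _ _ _ (fun w : V => w - Phi (z j)) Num.norm).
    apply: (@continuousB R V V id (fun=> Phi (z j))) => //.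
    exact: cst_continuous.
  exact: norm_continuous.
have csum (W : normedModType R) (U : topologicalType) (F : 'I_(size s) -> U -> W) :
    (forall j, continuous (F j)) -> continuous (fun w => \sum_j F j w).
  by move=> cF; apply: continuous_big => [|j _]; [exact: add_continuous|exact: cF].
exists (size s) => //.
exists (fun w => \row_j (b j w / S w)), (fun a => \sum_j a ord0 j *: G (z j)).
split.
- apply: row_continuous => j; under eq_fun do rewrite mxE.
  move=> w; apply: continuousM; first exact: cb.
  apply: continuousV; first by rewrite gt_eqF.
  apply: cmax; first by move=> ?; exact: cst_continuous.
  exact: csum.
- apply: csum => j a; apply: continuousZr_tmp; exact: coord_continuous.
move=> x Kx; set w := Phi x.
have Sb : S w = \sum_j b j w.
  have [y ys yx] := sP x Kx.
  have /(tnthP (in_tuple s))[j yj] := ys.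
  apply/max_idPr; rewrite (bigD1 j)//= ler_wpDr ?sumr_ge0//.
  rewrite le_max; apply/orP; right; rewrite /z -yj.
  by move: yx; rewrite -/w; lra.
have S1 : \sum_j b j w / S w = 1.
  by rewrite -big_distrl/= -Sb divff// gt_eqF.
have -> : G x - \sum_j (\row_j0 (b j0 w / S w)) ord0 j *: G (z j) =
    \sum_j (b j w / S w) *: (G x - G (z j)).
  under [RHS]eq_bigr do rewrite scalerBr.
  rewrite sumrB -scaler_suml S1 scale1r; congr (_ - _).
  by apply: eq_bigr => j _; rewrite mxE.
rewrite (le_trans (ler_norm_sum _ _ _))//.
rewrite -[leRHS]mul1r -S1 big_distrl/=; apply: ler_sum => j _.
have bS : 0 <= b j w / S w by rewrite divr_ge0// ltW.
rewrite normrZ ger0_norm//.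
have [wz|wz] := ltP `|w - Phi (z j)| delta.
  by rewrite ler_wpM2l// ltW// PhiG.
suff -> : b j w = 0 by rewrite !mul0r.
by apply/max_idPl; rewrite subr_le0.
Qed.

End factorization.

Theorem theorem2 (R : realType) (d k : nat) (hk : (k <= d)%N)
  (K : set (manifold_function R d k)) (hK : compact K)
  (Y : completeNormedModType R)
  (r : nat) (s t : R) (hs : 0 <= s <= r%:R) (ht : 0 < t)
  (kappa : nat -> nat) (hkappa : increasing_positive kappa)
  (phi : forall n, 'I_(kappa n) -> 'rV[R]_d -> R)
  (hphi : convergence_sequence phi r s t)
  (G : manifold_function R d k -> Y) (hG : {within K, continuous G})
  (eps : R) (heps : 0 < eps) :
  exists p q : nat, [/\ (0 < p)%N, (0 < q)%N &
    exists (Gt : 'rV[R]_(kappa q + kappa q) -> 'rV[R]_p) (u : 'rV[R]_p -> Y),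
      [/\ continuous Gt, continuous u &
          (ereal_sup [set `|G x - u (Gt (encoder phi q x))|%:E | x in K]
             < eps%:E)%E]].
Proof.
(* The supremum of values below a bound may reach it, hence the half. *)
have e20 : 0 < eps / 2 by rewrite divr_gt0.
have e40 : 0 < eps / 2 / 2 by rewrite divr_gt0.
have [q q0 qP] : exists2 q, (0 < q)%N & forall x y, K x -> K y ->
    encoder phi q x = encoder phi q y -> `|G x - G y| < eps / 2.
  (* Two elements at distance [0] may be different records; [G] takes the same
     value on them. Otherwise the encoders separate a neighbourhood. *)
  have : \forall n \near \oo, K `*` K `<=` [set p | (0 < n)%N ->
      encoder phi n p.1 = encoder phi n p.2 -> `|G p.1 - G p.2| < eps / 2].
    have /compact_near_coveringP/near_covering_withinP := compact_setX hK hK.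
    apply => -[x y] [/= Kx Ky].
    have [xy|/existsNP[e /not_implyP[e0 xy]]] :=
        pselect (forall e, 0 < e -> mf_ball x e y).
      have /nbhs_ballP[rho /= rho0 rhoP] := within_near hG Kx e40.
      exists (ball x rho `*` ball y (rho / 2), setT).
        split; last exact: filterT.
        exists (ball x rho, ball y (rho / 2)) => //.
        by split; apply: nbhsx_ballx => //; rewrite divr_gt0.
      move=> [[x' y'] n] [[/= xx' yy'] _] [/= Kx' Ky'] _ _.
      have xy' : ball x rho y'.
        rewrite (splitr rho); apply: mf_ball_triangle yy'.
        by apply: xy; rewrite divr_gt0.
      have := rhoP _ xx' Kx'; have := rhoP _ xy' Ky'.
      by have := ler_distD (G x) (G x') (G y'); rewrite (distrC (G x') (G x)); lra.
    have [rho rho0 [N NP]] := encoder_separates hphi ht e0 xy.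
    exists (ball x rho `*` ball y rho, [set n | (N <= n)%N]).
      split; last by exists N.
      by exists (ball x rho, ball y rho) => //; split; exact: nbhsx_ballx.
    by move=> [[x' y'] n] [[/= xx' yy'] Nn] _ n0 /(NP n Nn n0 x' y' xx' yy').
  move=> [N _ NP]; exists N.+1 => // x y Kx Ky.
  by apply: (NP N.+1 _ (x, y)) => //=.
have cphi m : in_C (phi q m) by case: hphi => /(_ q m q0) [].
have cenc := @encoder_continuous R d k kappa phi q cphi.
have [delta delta0 deltaP] := separated_modulus hK hG cenc qP.
have [p p0 [Gt [u [cGt cu GuP]]]] :=
  finite_factorization hK cenc delta0 deltaP.
exists p, q; split=> //; exists Gt, u; split=> //.
apply: (@le_lt_trans _ _ (eps / 2)%:E).
  by apply: ge_ereal_sup => _ [x Kx <-]; rewrite lee_fin GuP.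
by rewrite lte_fin ltr_pdivrMr// ltr_pMr// ltr1n.
Qed.
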